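(* Let $(L,B)$ be an upper crystal basis of $V\in\mathscr O^{int}_q(\mathfrak g)$ and let $G^{up}(B)$ be the corresponding upper global crystal basis. Let $\bar\cdot$ be any field involution of $\Bbbk$ with $\overline{q^{1/(2d)}}=q^{-1/(2d)}$, and denote also by $\bar\cdot$ the unique additive map $V\to V$ satisfying $\overline{b}=b$ and $\overline{f\cdot b}=\overline f\cdot b$ for all $f\in\Bbbk$, $b\in G^{up}(B)$. Then $\overline{\sigma^J(b)}=\sigma^J(b)$ for any $J\in\mathscr J$ and any $b\in G^{up}(B)$.
   Context: Root data. $I$ is a finite set, $A=(a_{ij})_{i,j\in I}$ a symmetrizable generalized Cartan matrix, $\mathfrak h$ a finite-dimensional complex vector space, $\{\alpha_i\}_{i\in I}\subset\mathfrak h^*$, $\{\alpha_i^\vee\}_{i\in I}\subset\mathfrak h$ linearly independent subsets, $(\cdot,\cdot)$ a symmetric non-degenerate bilinear form on $\mathfrak h^*$, $P\subset\mathfrak h^*$ a lattice of rank $\dim\mathfrak h^*$, such that $\alpha_j(\alpha_i^\vee)=a_{ij}$, $(\alpha_i,\alpha_i)\in 2\mathbb Z_{>0}$, $\lambda(\alpha_i^\vee)=2(\lambda,\alpha_i)/(\alpha_i,\alpha_i)$ for $\lambda\in\mathfrak h^*$, $\alpha_i\in P$, $\lambda(\alpha_i^\vee)\in\mathbb Z$ for $\lambda\in P$, and $(P,P)\subset\frac1d\mathbb Z$ for some $d\in\mathbb Z_{>0}$. The $\omega_i\in\mathfrak h^*$ defined by $\omega_i(\alpha_j^\vee)=\delta_{ij}$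 and $\omega_i(h)=0$ for $h\in\bigcap_{j}\ker\alpha_j$ are assumed to lie in $P$. $Q^+=\sum_i\mathbb Z_{\ge0}\alpha_i$; $P^+=\{\lambda\in P:\lambda(\alpha_i^\vee)\ge0\ \forall i\}$. $\mathfrak g$ is the Kac-Moody algebra attached to these data. The Weyl group $W$ is generated by $s_i$, $s_i\lambda=\lambda-\lambda(\alpha_i^\vee)\alpha_i$ on $\mathfrak h^*$ and $s_ih=h-\alpha_i(h)\alpha_i^\vee$ on $\mathfrak h$. Quantum group. $\Bbbk$ is a field of characteristic zero containing an element $q^{1/(2d)}$ transcendental over $\mathbb Q$; $q_i=q^{(\alpha_i,\alpha_i)/2}$; $(n)_v=\frac{v^n-v^{-n}}{v-v^{-1}}$, $(n)_v!=\prod_{s=1}^n(s)_v$, $X_i^{(n)}=X_i^n/(n)_{q_i}!$. $U_q(\mathfrak g)$ is the $\Bbbk$-algebra generated by $E_i,F_i$ ($i\in I$), $K_\lambda$ ($\lambda\in\frac12P$, $K_\lambda K_\mu=K_{\lambda+\mu}$, $K_0=1$) with relations $K_\lambda E_i=q^{(\lambda,\alpha_i)}E_iK_\lambda$, $K_\lambda F_i=q^{-(\lambda,\alpha_i)}F_iK_\lambda$, $[E_i,F_j]=\delta_{ij}\frac{K_{\alpha_i}-K_{-\alpha_i}}{q_i-q_i^{-1}}$ and the quantum Serre relations $\sum_{r+s=1-a_{ij}}(-1)^rE_i^{(r)}E_jE_i^{(s)}=0=\sum_{r+s=1-a_{ij}}(-1)^rF_i^{(r)}F_jF_i^{(s)}$,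 $i\ne j$. $U_q^{+}(\mathfrak g)$ is the subalgebra generated by the $E_i$, graded by $Q^+$ with $\deg E_i=\alpha_i$. Category. $\mathscr O^{int}_q(\mathfrak g)$ is the full subcategory of $U_q(\mathfrak g)$-modules $M$ such that $M=\bigoplus_{\beta\in P}M(\beta)$, $M(\beta)=\{m:K_\lambda(m)=q^{(\lambda,\beta)}m\ \forall\lambda\in\frac12P\}$, all $E_i,F_i$ act locally nilpotently, and for each $m\in M$ there is $N(m)\ge0$ with $U_q^+(\mathfrak g)(\nu)(m)=0$ for every $\nu=\sum n_i\alpha_i\in Q^+$ with $\sum n_i\ge N(m)$. It is semisimple with simple objects the simple highest weight modules $V_\lambda$, $\lambda\in P^+$. Operators $\sigma^J$. $\mathscr J$ is the set of non-empty $J\subset I$ for which $W_J=\langle s_j:j\in J\rangle$ is finite; $w_\circ^J$ is the longest element of $W_J$; for $j\in J$, $j^\star\in J$ is determined by $s_{j^\star}=w_\circ^Js_jw_\circ^J$. For $w\in W_J$ with a reduced expression $w=s_{i_1}\cdots s_{i_m}$ and $\lambda\in P$ with $\lambda(\alpha_j^\vee)\ge0$ for all $j\in J$ put $F_{w,\lambda}=F_{i_1}^{(a_1)}\cdots F_{i_m}^{(a_m)}$, $a_k=\lambda(s_{i_m}\cdots s_{i_{k+1}}\alpha_{i_k}^\vee)$ (independent of the reduced expression). For $v\in\bigcap_{j\in J}\ker E_j$ with weight components $v(\lambda)\in V(\lambda)$ put $v^J=\sum_\lambda F_{w_\circ^J,\lambda}(v(\lambda))$. For $V\in\mathscr O^{int}_q(\mathfrak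 g)$, $\sigma^J=\sigma^J_V$ is the unique $\Bbbk$-linear map $V\to V$ with $\sigma^J(v)=v^J$ for $v\in\bigcap_{j\in J}\ker E_j$ and $\sigma^J(F_j(v))=E_{j^\star}(\sigma^J(v))$, $\sigma^J(E_j(v))=F_{j^\star}(\sigma^J(v))$ for $j\in J$, $v\in V$. Crystal bases. For $V\in\mathscr O^{int}_q(\mathfrak g)$, $V=\bigoplus_{0\le k\le l}F_i^{(k)}(\ker E_i\cap\ker(K_{\alpha_i}-q_i^l))$. For $s\in\mathbb Z$ define operators by, for $u\in\ker E_i\cap\ker(K_{\alpha_i}-q_i^l)$, $0\le k\le l$: $\tilde e^{low}_{i,s}(F_i^{(k)}(u))=F_i^{(k-s)}(u)$, $\tilde e^{up}_{i,s}(F_i^{(k)}(u))=\frac{(l-k+s)_{q_i}!(k-s)_{q_i}!}{(l-k)_{q_i}!(k)_{q_i}!}F_i^{(k-s)}(u)$ if $k-l\le s\le k$, and $0$ otherwise (Kashiwara's lower and upper operators $\tilde e_i^s$). $\mathbb A\subset\mathbb Q(q)\subset\Bbbk$ is the ring of rational functions regular at $q=0$. An upper crystal basis of $V$ at $q=0$ is a pair $(L,B)$: $L\subset V$ an $\mathbb A$-submodule with $V=\Bbbk\otimes_{\mathbb A}L$, $L=\bigoplus_\beta(L\cap V(\beta))$, $\tilde e^{up}_{i,s}(L)\subset L$ for all $i,s$, and $B$ a weight basis of the $\mathbb Q$-space $L/qL$ with $\tilde e^{up}_{i,s}(B)\subset B\cup\{0\}$. Upper global crystal bases (Kashiwara).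 Fix $v_\lambda\in V_\lambda(\lambda)\setminus\{0\}$. Let $L_\lambda^{low}$ be the smallest $\mathbb A$-submodule of $V_\lambda$ containing $v_\lambda$ and stable under the $\tilde e_{i,s}^{low}$, $s<0$, and $B^{low}_\lambda\subset L_\lambda^{low}/qL_\lambda^{low}$ the set of non-zero images of the vectors obtained from $v_\lambda$ by applying these operators. Let $V_\lambda^{\mathbb Z}$ be the $\mathbb Z[q^{\pm1}]$-span of the vectors $F_{i_1}^{(n_1)}\cdots F_{i_r}^{(n_r)}v_\lambda$, and let the bar map on $V_\lambda^{\mathbb Z}$ be the additive map with $\overline{q}=q^{-1}$ fixing these vectors. The lower global basis of $V_\lambda$ is the unique basis $\{G(b)\}_{b\in B^{low}_\lambda}$ with $G(b)\in V_\lambda^{\mathbb Z}\cap L_\lambda^{low}$, $\overline{G(b)}=G(b)$, $G(b)\equiv b\bmod qL_\lambda^{low}$. The upper global basis $\mathbf B_\lambda$ of $V_\lambda$ is its dual basis with respect to the symmetric bilinear form on $V_\lambda$ with $(v_\lambda,v_\lambda)=1$, $(F_iu,u')=(u,E_iu')$, $(K_\mu u,u')=(u,K_\mu u')$; the $\mathbb A$-span $L_\lambda$ of $\mathbf B_\lambda$ and the image $B_\lambda$ of $\mathbf B_\lambda$ in $L_\lambda/qL_\lambda$ form an upper crystal basis of $V_\lambda$. For a general $V$ with upper crystal basis $(L,B)$, there is an isomorphism $V\cong\bigoplus_jV_{\lambda_j}$ identifying $(L,B)$ with $\bigoplus_j(L_{\lambda_j},B_{\lambda_j})$, and the corresponding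 upper global crystal basis $G^{up}(B)$ is the preimage of $\bigsqcup_j\mathbf B_{\lambda_j}$. *)

(* Defs.v *)
From HB Require Import structures.
From mathcomp Require Import all_boot all_order all_algebra.
From mathcomp Require Import complex.
From mathcomp Require Import boolp classical_sets functions cardinality reals.

Set Implicit Arguments.
Unset Strict Implicit.
Unset Printing Implicit Defensive.

Import Order.TTheory GRing.Theory Num.Theory.
Local Open Scope classical_set_scope.
Local Open Scope ring_scope.

Definition is_gcm (I : finType) (a : I -> I -> int) : Prop :=
  [/\ forall i, a i i = 2,
      forall i j, i != j -> a i j <= 0
    & forall i j, a i j = 0 -> a j i = 0].

Definition is_symmetrizable (I : finType) (a : I -> I -> int) : Prop :=
  exists2 D : I -> rat, forall i, 0 < D i
                      & forall i j, D i * (a i j)%:~R = D j * (a j i)%:~R.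

Definition int_span (K : fieldType) (U : vectType K) (b : seq U) : set U :=
  [set x | exists c : 'I_(size b) -> int, x = \sum_(k < size b) b`_k *~ c k].

(* 'Hom(h, R[i]^o) is the dual of the complex vector space h. *)
Record root_data (R : realType) (I : finType) (h : vectType R[i]) := RootData {
  cartan : I -> I -> int;
  rt : I -> 'Hom(h, R[i]^o);
  crt : I -> h;
  form : {biscalar 'Hom(h, R[i]^o)};
  wlat : set 'Hom(h, R[i]^o);
  den : nat;
  cartan_gcm : is_gcm cartan;
  cartan_sym : is_symmetrizable cartan;
  rt_free : free (codom rt);
  crt_free : free (codom crt);
  form_sym : forall x y, form x y = form y x;
  form_nondeg : forall x, (forall y, form x y = 0) -> x = 0;
  (* a full lattice: the integral span of a basis of the dual space *)
  wlat_lattice : exists2 b, basis_of fullv b & wlat = int_span b;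
  rt_crt : forall i j, rt j (crt i) = (cartan i j)%:~R;
  form_rt : forall i, exists2 n : nat, (0 < n)%N & form (rt i) (rt i) = (2 * n)%:R;
  crt_form : forall (x : 'Hom(h, R[i]^o)) i, x (crt i) = 2 * form x (rt i) / form (rt i) (rt i);
  rt_wlat : forall i, wlat (rt i);
  wlat_int : forall (x : 'Hom(h, R[i]^o)) i, wlat x -> exists n : int, x (crt i) = n%:~R;
  den_gt0 : (0 < den)%N;
  form_wlat : forall x y, wlat x -> wlat y ->
    exists n : int, form x y = n%:~R / den%:R;
  (* w is omega_i; if the Cartan matrix is singular, some i have no such w *)
  fundamental_wlat : forall i (w : 'Hom(h, R[i]^o)),
    (forall j, w (crt j) = (i == j)%:R) ->
    (forall x, (forall j, rt j x = 0) -> w x = 0) -> wlat w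
}.

Section Weyl.
Context {R : realType} {I : finType} {h : vectType R[i]}.
Variable D : root_data I h.
Implicit Types (i j : I) (s : seq I) (J : {set I}) (x : 'Hom(h, R[i]^o)).

Definition half_wlat : set 'Hom(h, R[i]^o) := [set x | wlat D (x *+ 2)].

Definition dominant : set 'Hom(h, R[i]^o) :=
  [set x | wlat D x /\ forall i, 0 <= x (crt D i)].

Definition refl i x : 'Hom(h, R[i]^o) := x - x (crt D i) *: rt D i.
Definition corefl i (y : h) : h := y - rt D i y *: crt D i.

(* The word [:: i1; ...; im] acts as s_i1 ... s_im; as the simple reflections
   are involutions, the words in J run over the subgroup W_J. *)
Definition word_act s x := foldr refl x s.
Definition word_coact s (y : h) := foldr corefl y s.

Definition word_in J s := {subset s <= J}.

Definition parabolic J : set ('Hom(h, R[i]^o) -> 'Hom(h, R[i]^o)) :=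
  [set w | exists2 s, word_in J s & w = word_act s].

Definition finite_parabolic J : Prop := J != finset.set0 /\ finite_set (parabolic J).

Definition reduced J s : Prop :=
  word_in J s /\
  forall s', word_in J s' -> word_act s' = word_act s -> (size s <= size s')%N.

(* s is a reduced expression of the longest element of W_J *)
Definition reduced_longest J s : Prop :=
  reduced J s /\ forall s', reduced J s' -> (size s' <= size s)%N.

(* j' = j^star, where s is an expression of the longest element of W_J *)
Definition is_star J s j j' : Prop :=
  [/\ j \in J, j' \in J & refl j' = word_act s \o refl j \o word_act s].

End Weyl.

Section QuantumGroup.
Context {R : realType} {I : finType} {h : vectType R[i]}.
Variable D : root_data I h.
Context {k : fieldType}.
Variable t : k. (* q^(1/2d) *)

Definition qq : k := t ^+ (2 * den D).

(* q^c for c in (1/2d)Z, as an integral power of t *)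
Definition qpow (c : R[i]) : k :=
  t ^ (xget 0 [set n : int | n%:~R = c * (2 * den D)%:R]).

Definition qi (i : I) : k := qpow (form D (rt D i) (rt D i) / 2).

Definition qnum (v : k) (n : nat) : k := (v ^+ n - v ^- n) / (v - v^-1).
Definition qfact (v : k) (n : nat) : k := \prod_(1 <= s < n.+1) qnum v s.

Definition divpow (V : lmodType k) (v : k) (X : V -> V) (n : nat) (m : V) : V :=
  (qfact v n)^-1 *: iter n X m.

(* A module over the algebra presented by the generators E_i, F_i, K_x and the
   defining relations of U_q(g). Only the K_x with x in half_wlat are
   generators; Kop is unconstrained, and never used, elsewhere. *)
Record Uq_module := UqModule {
  carrier :> lmodType k;
  Eop : I -> {linear carrier -> carrier};
  Fop : I -> {linear carrier -> carrier};
  Kop : 'Hom(h, R[i]^o) -> {linear carrier -> carrier};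
  Kop0 : forall m, Kop 0 m = m;
  KopD : forall x y m, half_wlat D x -> half_wlat D y ->
    Kop x (Kop y m) = Kop (x + y) m;
  KEop : forall x i m, half_wlat D x ->
    Kop x (Eop i m) = qpow (form D x (rt D i)) *: Eop i (Kop x m);
  KFop : forall x i m, half_wlat D x ->
    Kop x (Fop i m) = qpow (- form D x (rt D i)) *: Fop i (Kop x m);
  EFop : forall i j m, Eop i (Fop j m) - Fop j (Eop i m) =
    (i == j)%:R *: ((qi i - (qi i)^-1)^-1 *: (Kop (rt D i) m - Kop (- rt D i) m));
  serreE : forall i j m, i != j -> let n := `|1 - cartan D i j|%N in
    \sum_(r < n.+1) (-1) ^+ r *:
      divpow (qi i) (Eop i) r (Eop j (divpow (qi i) (Eop i) (n - r) m)) = 0;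
  serreF : forall i j m, i != j -> let n := `|1 - cartan D i j|%N in
    \sum_(r < n.+1) (-1) ^+ r *:
      divpow (qi i) (Fop i) r (Fop j (divpow (qi i) (Fop i) (n - r) m)) = 0
}.

Definition Ediv (V : Uq_module) i n (m : V) : V := divpow (qi i) (Eop V i) n m.
Definition Fdiv (V : Uq_module) i n (m : V) : V := divpow (qi i) (Fop V i) n m.

Definition wspace (V : Uq_module) (b : 'Hom(h, R[i]^o)) : set V :=
  [set m | forall x, half_wlat D x -> Kop V x m = qpow (form D x b) *: m].

Definition in_kerE (V : Uq_module) (J : {set I}) : set V :=
  [set m | forall j, j \in J -> Eop V j m = 0].

(* V is the direct sum of the wspace b, b in wlat *)
Definition weight_decomposition (V : Uq_module) : Prop :=
  (forall m : V, exists n (b : 'I_n -> 'Hom(h, R[i]^o)) (x : 'I_n -> V),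
     (forall a, wlat D (b a) /\ wspace (b a) (x a)) /\ m = \sum_(a < n) x a) /\
  (forall n (b : 'I_n -> 'Hom(h, R[i]^o)) (x : 'I_n -> V), injective b ->
     (forall a, wlat D (b a) /\ wspace (b a) (x a)) ->
     \sum_(a < n) x a = 0 -> forall a, x a = 0).

Definition locally_nilpotent (V : lmodType k) (X : V -> V) : Prop :=
  forall m, exists n, iter n X m = 0.

(* The last condition: the homogeneous component of degree nu of the subalgebra
   generated by the E_i is spanned by the products of the E_i of degree nu, and
   the number of factors is the height of nu. *)
Record in_Oint (V : Uq_module) : Prop := InOint {
  Oint_weight : weight_decomposition V;
  Oint_E : forall i, locally_nilpotent (Eop V i);
  Oint_F : forall i, locally_nilpotent (Fop V i);
  Oint_E_bound : forall m : V, exists N : nat, forall s : seq I,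
    (N <= size s)%N -> foldr (fun i => Eop V i) m s = 0
}.

Definition is_Uq_submodule (V : Uq_module) (N : set V) : Prop :=
  [/\ N 0, forall x y, N x -> N y -> N (x + y), forall (c : k) x, N x -> N (c *: x)
    & [/\ forall i x, N x -> N (Eop V i x), forall i x, N x -> N (Fop V i x)
        & forall l x, half_wlat D l -> N x -> N (Kop V l x)]].

Definition is_simple (V : Uq_module) : Prop :=
  (exists m : V, m != 0) /\
  forall N : set V, is_Uq_submodule N -> N = [set 0] \/ N = setT.

Definition is_Uq_morphism (V V' : Uq_module) (f : V -> V') : Prop :=
  [/\ forall i m, f (Eop V i m) = Eop V' i (f m),
      forall i m, f (Fop V i m) = Fop V' i (f m)
    & forall x m, half_wlat D x -> f (Kop V x m) = Kop V' x (f m)].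

(* V is V_l and v is v_l *)
Definition is_simple_hw (V : Uq_module) (l : 'Hom(h, R[i]^o)) (v : V) : Prop :=
  [/\ in_Oint V, is_simple V, v != 0, wspace l v & forall i, Eop V i v = 0].

Definition to_nat (c : R[i]) : nat := xget 0%N [set n : nat | n%:R = c].

(* F_{w,l} for the reduced expression w = s: the exponent of the first letter i
   of i :: s' is l (s'^-1 alpha_i^vee), and s'^-1 is the reversed word. *)
Fixpoint Fw (V : Uq_module) (s : seq I) (l : 'Hom(h, R[i]^o)) (m : V) : V :=
  if s is i :: s' then
    Fdiv i (to_nat (l (word_coact D (rev s') (crt D i)))) (Fw s' l m)
  else m.

(* s is meant to be a reduced expression of the longest element of W_J; the right
   hand side of the first clause is then v^J for v = \sum_a x a. *)
Definition sigma_spec (V : Uq_module) (J : {set I}) (s : seq I)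
    (f : {linear V -> V}) : Prop :=
  [/\ forall n (l : 'I_n -> 'Hom(h, R[i]^o)) (x : 'I_n -> V), injective l ->
        (forall a, wlat D (l a) /\ wspace (l a) (x a)) ->
        in_kerE J (\sum_(a < n) x a) ->
        f (\sum_(a < n) x a) = \sum_(a < n) Fw s (l a) (x a),
      forall j j' m, is_star D J s j j' -> f (Fop V j m) = Eop V j' (f m)
    & forall j j' m, is_star D J s j j' -> f (Eop V j m) = Fop V j' (f m)].

Definition is_sigma (V : Uq_module) (J : {set I}) (s : seq I)
    (f : {linear V -> V}) : Prop :=
  sigma_spec J s f /\ forall g : {linear V -> V}, sigma_spec J s g -> g =1 f.

Definition low_coef (i : I) (l n n' : nat) : k := 1.
Definition up_coef (i : I) (l n n' : nat) : k :=
  (qfact (qi i) (l - n') * qfact (qi i) n') / (qfact (qi i) (l - n) * qfact (qi i) n).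

(* The image of F_i^(n) u under the operator of index s, where n' = n - s *)
Definition crystal_term (coef : I -> nat -> nat -> nat -> k) (V : Uq_module)
    (i : I) (s : int) (l n : nat) (u : V) : V :=
  if (n%:Z - s)%R is Posz n' then
    if (n' <= l)%N then coef i l n n' *: Fdiv i n' u else 0
  else 0.

(* The graph of the operator: y is the image of x. *)
Definition crystal_op (coef : I -> nat -> nat -> nat -> k) (V : Uq_module)
    (i : I) (s : int) (x y : V) : Prop :=
  exists N (l n : 'I_N -> nat) (u : 'I_N -> V),
    [/\ forall a, [/\ (n a <= l a)%N, Eop V i (u a) = 0
                    & Kop V (rt D i) (u a) = qi i ^+ l a *: u a],
        x = \sum_(a < N) Fdiv i (n a) (u a)
      & y = \sum_(a < N) crystal_term coef i s (l a) (n a) (u a)].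

Definition e_low (V : Uq_module) := @crystal_op low_coef V.
Definition e_up (V : Uq_module) := @crystal_op up_coef V.

(* Rational functions of q over the rationals, regular at q = 0 *)
Definition regA : set k :=
  [set c | exists f g : {poly rat}, g.[0] != 0 /\
    c = (map_poly ratr f).[qq] / (map_poly ratr g).[qq]].

Definition laurentZ : set k :=
  [set c | exists (f : {poly int}) (n : nat), c = (map_poly intr f).[qq] / qq ^+ n].

Definition span_over (A : set k) (V : lmodType k) (S : set V) : set V :=
  [set x | exists n (c : 'I_n -> k) (b : 'I_n -> V),
    (forall a, A (c a) /\ S (b a)) /\ x = \sum_(a < n) c a *: b a].

Definition is_Asubmodule (V : lmodType k) (L : set V) : Prop :=
  [/\ L 0, forall x y, L x -> L y -> L (x + y)
    & forall c x, regA c -> L x -> L (c *: x)].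

(* V is the extension of scalars of L from regA to k: the universal property *)
Definition is_scalar_extension (V : lmodType k) (L : set V) : Prop :=
  forall (W : lmodType k) (f : V -> W),
    (forall x y, L x -> L y -> f (x + y) = f x + f y) ->
    (forall c x, regA c -> L x -> f (c *: x) = c *: f x) ->
    exists g : {linear V -> W}, (forall x, L x -> g x = f x) /\
      forall g' : {linear V -> W}, (forall x, L x -> g' x = f x) -> g' =1 g.

Definition qmul (V : lmodType k) (L : set V) : set V := [set qq *: x | x in L].

(* The class of x in L/qL; sets of elements of L/qL are sets of such classes. *)
Definition cls (V : lmodType k) (L : set V) (x : V) : set V :=
  [set y | qmul L (y - x)].

Definition is_weight_Qbasis (V : Uq_module) (L : set V) (B : set (set V)) : Prop :=
  [/\ forall b, B b -> exists x l, [/\ L x, wlat D l, wspace l x & b = cls L x],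
      forall x, L x -> exists n (c : 'I_n -> rat) (y : 'I_n -> V),
        (forall a, L (y a) /\ B (cls L (y a))) /\
        qmul L (x - \sum_(a < n) ratr (c a) *: y a)
    & forall n (c : 'I_n -> rat) (y : 'I_n -> V),
        (forall a, L (y a) /\ B (cls L (y a))) ->
        injective (fun a => cls L (y a)) ->
        qmul L (\sum_(a < n) ratr (c a) *: y a) -> forall a, c a = 0].

Record is_upper_crystal_basis (V : Uq_module) (L : set V) (B : set (set V)) : Prop :=
  UpperCrystalBasis {
    ucb_submodule : is_Asubmodule L;
    ucb_extension : is_scalar_extension L;
    ucb_weight : forall x, L x ->
      exists n (l : 'I_n -> 'Hom(h, R[i]^o)) (y : 'I_n -> V),
        (forall a, [/\ wlat D (l a), L (y a) & wspace (l a) (y a)]) /\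
        x = \sum_(a < n) y a;
    ucb_stable : forall i s x y, L x -> e_up i s x y -> L y;
    ucb_basis : is_weight_Qbasis L B;
    ucb_crystal : forall i s x y, L x -> B (cls L x) -> e_up i s x y ->
      B (cls L y) \/ qmul L y
  }.

Definition is_family_basis (V : lmodType k) (T : Type) (S : set T) (G : T -> V) : Prop :=
  (forall x, exists n (c : 'I_n -> k) (b : 'I_n -> T),
     (forall a, S (b a)) /\ x = \sum_(a < n) c a *: G (b a)) /\
  (forall n (c : 'I_n -> k) (b : 'I_n -> T), injective b -> (forall a, S (b a)) ->
     \sum_(a < n) c a *: G (b a) = 0 -> forall a, c a = 0).

Section Simple.
Variables (V : Uq_module) (v : V).

Definition low_lattice : set V :=
  [set x | forall L : set V, is_Asubmodule L -> L v ->
    (forall i s y z, s < 0 -> L y -> e_low i s y z -> L z) -> L x].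

Inductive low_vector : V -> Prop :=
| low_vector0 : low_vector v
| low_vectorS i s x y : s < 0 -> low_vector x -> e_low i s x y -> low_vector y.

Definition low_basis : set (set V) :=
  [set b | exists x, [/\ low_vector x, ~ qmul low_lattice x & b = cls low_lattice x]].

Definition Fmonomial (w : seq (I * nat)) : V :=
  foldr (fun p => @Fdiv V p.1 p.2) v w.

Definition VZ : set V := span_over laurentZ (range Fmonomial).

Definition is_VZ_bar (bar : V -> V) : Prop :=
  [/\ forall x, VZ x -> VZ (bar x),
      forall x y, VZ x -> VZ y -> bar (x + y) = bar x + bar y,
      forall x, VZ x -> bar (qq *: x) = qq^-1 *: bar x
    & forall w, bar (Fmonomial w) = Fmonomial w].

(* G is meaningful on low_basis only. *)
Definition is_lower_global_basis (G : set V -> V) : Prop :=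
  is_family_basis low_basis G /\
  exists2 bar, is_VZ_bar bar
  & forall b, low_basis b ->
      [/\ VZ (G b), low_lattice (G b), bar (G b) = G b & b = cls low_lattice (G b)].

Definition is_contravariant_form (f : {biscalar V}) : Prop :=
  [/\ f v v = 1, forall x y, f x y = f y x,
      forall i x y, f (Fop V i x) y = f x (Eop V i y)
    & forall l x y, half_wlat D l -> f (Kop V l x) y = f x (Kop V l y)].

Definition is_simple_upper_global_basis (BB : set V) : Prop :=
  exists (f : {biscalar V}) (G G' : set V -> V),
    [/\ is_contravariant_form f, is_lower_global_basis G,
        is_family_basis low_basis G',
        forall b b', low_basis b -> low_basis b' -> f (G b) (G' b') = (b == b')%:R
      & BB = [set G' b | b in low_basis]].

End Simple.

(* GB is an upper global basis of V attached to (L, B). The maps phi a form an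
   isomorphism from the direct sum of the simple modules M a to V, which
   identifies (L, B) with the direct sum of the pairs (L_a, B_a), where L_a is
   the regA-span of BB a and B_a is the image of BB a in L_a/qL_a. *)
Definition is_upper_global_basis (V : Uq_module) (L : set V) (B : set (set V))
    (GB : set V) : Prop :=
  exists (X : Type) (M : X -> Uq_module) (l : X -> 'Hom(h, R[i]^o))
      (v : forall a, M a) (BB : forall a, set (M a)) (phi : forall a, {linear M a -> V}),
    [/\ forall a, [/\ dominant D (l a), is_simple_hw (l a) (v a),
                      is_simple_upper_global_basis (v a) (BB a)
                    & is_Uq_morphism (phi a)],
        (forall x, exists n (a : 'I_n -> X) (y : forall r, M (a r)),
           x = \sum_(r < n) phi (a r) (y r)) /\
        (forall n (a : 'I_n -> X) (y : forall r, M (a r)), injective a ->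
           \sum_(r < n) phi (a r) (y r) = 0 -> forall r, y r = 0),
        L = [set x | exists n (a : 'I_n -> X) (y : forall r, M (a r)),
               (forall r, span_over regA (BB (a r)) (y r)) /\
               x = \sum_(r < n) phi (a r) (y r)],
        B = [set cl | exists a b, BB a b /\ cl = cls L (phi a b)]
      & GB = [set x | exists a b, BB a b /\ x = phi a b]].

End QuantumGroup.

(* Main.v *)
Require Import Defs.
From HB Require Import structures.
From mathcomp Require Import all_boot all_order all_algebra.
From mathcomp Require Import complex.
From mathcomp Require Import boolp classical_sets functions cardinality reals.

Set Implicit Arguments.
Unset Strict Implicit.
Unset Printing Implicit Defensive.

Import Order.TTheory GRing.Theory Num.Theory.
Local Open Scope ring_scope.

(** The linear map [sigma] is characterized by its values on the highest weight
vectors for [J] and by the rule that it exchanges the F_j and the E_j. Let c be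
the semilinear map of [V] that fixes the upper global basis. If c is involutive,
commutes with all E_i and F_i and preserves the weight spaces, then
c o sigma o c is linear and obeys the same characterization, because the
quantum factorials in the divided powers are invariant under q -> 1/q. So it
equals [sigma], and since c fixes the basis element b, it fixes sigma b
([sigma_bar]).

That c has these properties is checked on each simple summand M = V_lambda, by
duality. Let k0 be the subfield of k fixed by the involution, and let M0 be the
k0-span of the vectors F_i1 ... F_ir v_lambda ([real_form]). Three facts about
M0 do the work.
- M0 is stable under the F_i, and under the E_i because the commutator
  [E_i, F_i] acts on a weight vector by a quantum integer, which lies in k0.
- The contravariant form takes values in k0 on M0 ([form_real]).
- M0 contains the lower global basis: a bar-invariant element of the integral
  form is the half-sum of itself and its conjugate ([VZ_bar_fixed]).
By the last two facts and duality, pairing an upper global basis element with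
M0 also gives values in k0 ([conjugate_dual]). Hence c can be described without
the basis: y = c x if and only if (m, y) is the conjugate of (m, x) for every m
in M0 ([conjugate]). As E_i and F_i are adjoint and M0 is stable under both,
this relation is preserved by E_i and F_i; as K_mu multiplies each spanning
vector of M0 by a power of q, the relation carries K_mu to K_-mu, so c
preserves weights. *)

(** * Conjugation of scalars *)

Section Scalars.
Context {R : realType} {I : finType} {h : vectType R[i]}.
Variable D : root_data I h.
Context {k : fieldType} {t : k}.
Variable bar : {rmorphism k -> k}.
Hypothesis bar_t : bar t = t^-1.

Local Notation qpow := (qpow D t).
Local Notation qi := (qi D t).

Lemma wlat_add x y : wlat D x -> wlat D y -> wlat D (x + y).
Proof.
have [b _ ->] := wlat_lattice D => -[c ->] [c' ->].
exists (fun a => c a + c' a).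
by rewrite -big_split; apply: eq_bigr => a _; rewrite mulrzDr.
Qed.

Lemma wlat_opp x : wlat D x -> wlat D (- x).
Proof.
have [b _ ->] := wlat_lattice D => -[c ->]; exists (fun a => - c a).
by rewrite -sumrN; apply: eq_bigr => a _; rewrite mulrNz.
Qed.

Lemma half_wlat_opp x : half_wlat D x -> half_wlat D (- x).
Proof. by rewrite /half_wlat /= mulNrn; apply: wlat_opp. Qed.

Lemma half_wlat_rt i : half_wlat D (rt D i).
Proof. by rewrite /half_wlat /= mulr2n; apply: wlat_add; apply: rt_wlat. Qed.

(** Holds for every complex [c]: outside (1/2d)Z both sides are [t ^ 0]. *)
Lemma qpow_opp c : qpow (- c) = (qpow c)^-1.
Proof.
rewrite /Defs.qpow invr_expz; congr (t ^ _).
set P := [set n : int | n%:~R = c * _]%classic.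
set P' := [set n : int | n%:~R = - c * _]%classic.
have [[n Pn]|nP] := pselect (exists n, P n).
  have inj (m m' : int) : m%:~R = m'%:~R :> R[i] -> m = m'.
    by move/eqP; rewrite eqr_int => /eqP.
  rewrite (@xget_unique _ _ P n) //; last first.
    by move=> m Pm; apply: inj; rewrite Pm Pn.
  have P'n : P' (- n) by rewrite /P' /= mulrNz mulNr; congr (- _).
  rewrite (@xget_unique _ _ P' (- n)) // => m P'm.
  by apply: inj; rewrite P'm P'n.
have nP' n : ~ P' n.
  by move=> P'n; apply: nP; exists (- n); rewrite /P /= mulrNz P'n mulNr opprK.
by rewrite (xgetPN _ nP') xgetPN // => n Pn; apply: nP; exists n.
Qed.

Lemma bar_qpow c : bar (qpow c) = qpow (- c).
Proof. by rewrite qpow_opp /Defs.qpow fmorphXz bar_t exprz_inv invr_expz. Qed.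

Lemma bar_qi i : bar (qi i) = (qi i)^-1.
Proof. by rewrite /Defs.qi bar_qpow qpow_opp. Qed.

Lemma bar_qq : bar (qq D t) = (qq D t)^-1.
Proof. by rewrite /qq rmorphXn /= bar_t exprVn. Qed.

Lemma bar_qnum (v : k) n : bar v = v^-1 -> bar (qnum v n) = qnum v n.
Proof.
move=> bv; rewrite /qnum rmorphM fmorphV !rmorphB !fmorphV rmorphXn /= bv invrK.
by rewrite exprVn invrK -[v^-1 - v]opprB -[v ^- n - _]opprB invrN mulrNN.
Qed.

Lemma bar_qfact (v : k) n : bar v = v^-1 -> bar (qfact v n) = qfact v n.
Proof.
by move=> bv; rewrite rmorph_prod; apply: eq_bigr => s _; rewrite bar_qnum.
Qed.

End Scalars.

(** * Dual bases *)

Section DualBases.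
Context {k : fieldType} {V : lmodType k} {T : choiceType}.
Variables (f : {biscalar V}) (S : set T) (G G' : T -> V).
Hypothesis dualGG' : forall b b', S b -> S b' -> f (G b) (G' b') = (b == b')%:R.

(** Only finitely many elements of [S] occur in an expansion of [y]; after
    merging repeated ones, the coefficient at [b] is [f (G b) y]. *)
Lemma dual_basis_inj y :
  is_family_basis S G' -> (forall b, S b -> f (G b) y = 0) -> y = 0.
Proof.
move=> [spanG' _] fy0; have [n [c [b [Sb yE]]]] := spanG' y.
pose r := undup (codom b).
have y_r : y = \sum_(x <- r) \sum_(a < n | b a == x) c a *: G' (b a).
  rewrite yE (exchange_big_dep predT) //=; apply: eq_bigr => a _.
  rewrite (eq_bigl (pred1 (b a))) => [|x]; last by rewrite /= eq_sym.
  by rewrite -big_filter filter_pred1_uniq ?undup_uniq ?mem_undup ?codom_f //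
             big_seq1.
rewrite y_r big1_seq // => x /andP[_]; rewrite mem_undup => /codomP[a0 xE].
rewrite (eq_bigr (fun a => c a *: G' x)); last by move=> a /eqP->.
have Sx : S x by rewrite xE.
suff cx : \sum_(a < n | b a == x) c a = f (G x) y.
  by rewrite -scaler_suml cx fy0 // scale0r.
rewrite yE linear_sumr big_mkcond; apply: eq_bigr => a _.
by rewrite linearZr_LR /= dualGG' // eq_sym; case: eqP; rewrite ?mulr1 ?mulr0.
Qed.

End DualBases.

(** * The real form of a simple module *)

Section RealForm.
Context {R : realType} {I : finType} {h : vectType R[i]}.
Variable D : root_data I h.
Context {k : fieldType} {t : k}.
Variable bar : {rmorphism k -> k}.
Hypotheses (bar_invol : involutive bar) (bar_t : bar t = t^-1).
Variables (M : Uq_module D t) (l : 'Hom(h, R[i]^o)) (v : M).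
Hypothesis v_weight : wspace l v.
Hypothesis Ev : forall i, Eop M i v = 0.

Definition Fword (w : seq I) : M := foldr (fun i => Fop M i) v w.

(** The span of the words over the subfield of [k] fixed by [bar]. *)
Inductive real_form : M -> Prop :=
| real_form_word w : real_form (Fword w)
| real_formD x y : real_form x -> real_form y -> real_form (x + y)
| real_formZ c x : bar c = c -> real_form x -> real_form (c *: x).

Lemma real_form0 : real_form 0.
Proof. by rewrite -(scale0r v); apply: real_formZ (real_form_word [::]); rewrite rmorph0. Qed.

Lemma real_form_sum n (x : 'I_n -> M) :
  (forall a, real_form (x a)) -> real_form (\sum_(a < n) x a).
Proof.
by move=> rx; apply: big_ind => //; [apply: real_form0 | apply: real_formD].
Qed.

Lemma real_form_F i x : real_form x -> real_form (Fop M i x).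
Proof.
elim=> [w|y z _ IHy _ IHz|c y bc _ IHy].
- exact: (real_form_word (i :: w)).
- by rewrite linearD; apply: real_formD.
- by rewrite linearZ; apply: real_formZ.
Qed.

(** The eigenvalue is a product of powers of q; stating it up to conjugation is
    enough, and avoids adding up the exponents. *)
Lemma Fword_weight (m : 'Hom(h, R[i]^o)) w : half_wlat D m ->
  exists2 c, Kop M m (Fword w) = c *: Fword w
           & Kop M (- m) (Fword w) = bar c *: Fword w.
Proof.
move=> Hm; have HNm := half_wlat_opp Hm.
elim: w => [|i w [c Kc KNc]] /=.
  exists (qpow D t (Defs.form D m l)); rewrite v_weight //.
  by rewrite (bar_qpow D bar_t) linearNl.
exists (qpow D t (- Defs.form D m (rt D i)) * c).
  by rewrite KFop // Kc linearZ scalerA.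
by rewrite KFop // KNc linearZ scalerA rmorphM (bar_qpow D bar_t) linearNl.
Qed.

(** Moving E_i to the right through a word leaves the commutators, which act on
    the weight vector [Fword w] by quantum integers, and ends with E_i v = 0. *)
Lemma real_form_E i x : real_form x -> real_form (Eop M i x).
Proof.
elim=> [w|y z _ IHy _ IHz|c y bc _ IHy]; last 2 first.
- by rewrite linearD; apply: real_formD.
- by rewrite linearZ; apply: real_formZ.
elim: w => [|j w IHw] /=; first by rewrite Ev; apply: real_form0.
rewrite -[Eop M i _](subrK (Fop M j (Eop M i (Fword w)))) EFop.
apply: real_formD; last exact: real_form_F.
have [c -> ->] := Fword_weight w (half_wlat_rt D i).
rewrite -scalerBl !scalerA; apply: real_formZ; last exact: real_form_word.
(* The involution negates numerator and denominator of
   (c - bar c) / (q_i - q_i^-1). *)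
rewrite !rmorphM fmorphV !rmorphB fmorphV /= (bar_qi D bar_t) bar_invol invrK.
rewrite rmorph_nat -!mulrA; congr (_ * _).
by rewrite -[_^-1 - _]opprB -[bar c - c]opprB invrN mulrNN.
Qed.

Lemma real_form_Fdiv i n x : real_form x -> real_form (Fdiv i n x).
Proof.
move=> rx; apply: real_formZ.
  by rewrite fmorphV bar_qfact // (bar_qi D bar_t).
by elim: n => //= n; apply: real_form_F.
Qed.

Lemma real_form_Fmonomial w : real_form (Fmonomial v w).
Proof.
elim: w => [|p w IHw]; first exact: (real_form_word [::]).
exact: real_form_Fdiv.
Qed.

(** * The integral form and the lower global basis *)

Section LowerGlobal.
Hypotheses (t_neq0 : t != 0) (two_neq0 : 2 != 0 :> k).

Let qq_neq0 : qq D t != 0. Proof. exact: expf_neq0. Qed.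

Lemma laurentZM c d : laurentZ D t c -> laurentZ D t d -> laurentZ D t (c * d).
Proof.
move=> [f [n ->]] [g [m ->]]; exists (f * g), (n + m)%N.
by rewrite rmorphM hornerM exprD invfM mulrACA.
Qed.

Lemma VZD x y : VZ v x -> VZ v y -> VZ v (x + y).
Proof.
move=> [n [c [b [cb ->]]]] [m [d [e [de ->]]]].
exists (n + m)%N, (fun a => match fintype.split a with inl a => c a | inr a => d a end),
  (fun a => match fintype.split a with inl a => b a | inr a => e a end).
split=> [a|]; first by case: (fintype.split a).
rewrite big_split_ord; congr (_ + _); apply: eq_bigr => a _.
  by rewrite (unsplitK (inl a : 'I_n + 'I_m)).
by rewrite (unsplitK (inr a : 'I_n + 'I_m)).
Qed.

Lemma VZZ c x : laurentZ D t c -> VZ v x -> VZ v (c *: x).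
Proof.
move=> Ac [n [d [e [de ->]]]]; exists n, (fun a => c * d a), e; split=> [a|].
  by have [Ad Se] := de a; split=> //; apply: laurentZM.
by rewrite scaler_sumr; apply: eq_bigr => a _; rewrite scalerA.
Qed.

Lemma VZ_Fmonomial w : VZ v (Fmonomial v w).
Proof.
exists 1%N, (fun=> 1), (fun=> Fmonomial v w); split=> [_|].
  by split; [exists 1, 0%N; rewrite rmorph1 hornerC divr1 | exists w].
by rewrite big_ord1 scale1r.
Qed.

(** The conjugation of the integral form is additive and inverts q, so the
    scalars for which it is semilinear form a ring containing q and its inverse. *)
Lemma VZ_barZ barl c x : is_VZ_bar v barl -> laurentZ D t c -> VZ v x ->
  barl (c *: x) = bar c *: barl x.
Proof.
move=> [VZbar barD barq _].
pose Q c := laurentZ D t c /\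
  forall y, VZ v y -> barl (c *: y) = bar c *: barl y.
have QM c1 c2 : Q c1 -> Q c2 -> Q (c1 * c2).
  move=> [A1 Q1] [A2 Q2]; split=> [|y Zy]; first exact: laurentZM.
  by rewrite -scalerA Q1 ?Q2 ?rmorphM ?scalerA //; apply: VZZ.
have A0 : laurentZ D t 0 by exists 0, 0%N; rewrite rmorph0 horner0 mul0r.
have A1 : laurentZ D t 1 by exists 1, 0%N; rewrite rmorph1 hornerC divr1.
have Q0 : Q 0.
  split=> // y Zy; rewrite rmorph0 !scale0r.
  have Z0 : VZ v 0 by rewrite -(scale0r y); apply: VZZ.
  by apply: (addIr (barl 0)); rewrite -barD // !add0r.
have Q1 : Q 1 by split=> // y _; rewrite rmorph1 !scale1r.
have QN1 : Q (-1).
  have AN1 : laurentZ D t (-1).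
    by exists (-1), 0%N; rewrite !rmorphN !rmorph1 hornerN hornerC divr1.
  split=> // y Zy; rewrite rmorphN rmorph1 !scaleN1r; apply: (addIr (barl y)).
  have ZNy : VZ v (- y) by rewrite -scaleN1r; apply: VZZ.
  by rewrite -barD // !addNr; have := Q0.2 y Zy; rewrite rmorph0 !scale0r.
have QD c1 c2 : Q c1 -> Q c2 -> Q (c1 + c2).
  move=> [[f [n E1]] QA1] [[g [m E2]] QA2].
  have AD : laurentZ D t (c1 + c2).
    exists (f * 'X^m + g * 'X^n), (n + m)%N; rewrite E1 E2.
    rewrite rmorphD !rmorphM /= !map_polyXn hornerD !hornerM !hornerXn exprD.
    by rewrite addf_div ?expf_neq0.
  split=> // y Zy; rewrite scalerDl barD ?QA1 ?QA2 ?rmorphD ?scalerDl //.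
    by apply: VZZ => //; exists f, n.
  by apply: VZZ => //; exists g, m.
have Qq : Q (qq D t).
  split=> [|y Zy]; last by rewrite barq // (bar_qq D bar_t).
  by exists 'X, 0%N; rewrite map_polyX hornerX divr1.
have Qqi : Q (qq D t)^-1.
  have Ai : laurentZ D t (qq D t)^-1.
    by exists 1, 1%N; rewrite rmorph1 hornerC div1r expr1.
  split=> // y Zy; rewrite fmorphV (bar_qq D bar_t) invrK.
  by rewrite -[in RHS](scalerKV qq_neq0 y) barq ?scalerKV //; apply: VZZ.
have Qint (a : int) : Q a%:~R.
  elim/int_ind: a => [|a IHa|a IHa] //.
    by rewrite intS intrD; apply: (QD).
  by rewrite -addn1 PoszD opprD intrD mulrN1z; apply: (QD).
move=> [f [n ->]] Zx; suff [_ ->] : Q ((map_poly intr f).[qq D t] / qq D t ^+ n) by [].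
apply: (QM); last first.
  by elim: n => [|n IHn]; rewrite ?invr1 // exprS invfM; apply: (QM).
elim/poly_ind: f => [|f a IHf]; first by rewrite rmorph0 horner0.
rewrite rmorphD rmorphM /= map_polyX map_polyC !hornerE; apply: (QD); first exact: (QM).
exact: Qint.
Qed.

Lemma VZ_bar_sum barl n (c : 'I_n -> k) (w : 'I_n -> seq (I * nat)) :
  is_VZ_bar v barl -> (forall a, laurentZ D t (c a)) ->
  barl (\sum_(a < n) c a *: Fmonomial v (w a))
    = \sum_(a < n) bar (c a) *: Fmonomial v (w a).
Proof.
move=> barlP Ac; have [_ barD _ barm] := barlP.
have VZ0 : VZ v 0 by exists 0%N, (fun=> 0), (fun=> 0); split=> [[]|]; rewrite ?big_ord0.
(* Additivity of [barl] is available on VZ only, so membership is carried along. *)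
suff [_ ->] : VZ v (\sum_(a < n) c a *: Fmonomial v (w a)) /\
    barl (\sum_(a < n) c a *: Fmonomial v (w a))
    = \sum_(a < n) bar (c a) *: Fmonomial v (w a) by [].
apply: (big_ind2 (fun x y => VZ v x /\ barl x = y)).
- by split=> //; apply: (addIr (barl 0)); rewrite -barD // !add0r.
- by move=> x1 y1 x2 y2 [Z1 <-] [Z2 <-]; split; [apply: VZD | apply: barD].
- move=> a _; split; first by apply: VZZ => //; apply: VZ_Fmonomial.
  by rewrite (VZ_barZ barlP) ?barm //; apply: VZ_Fmonomial.
Qed.

(** If [x] is a combination of monomials with coefficients c_a, so is its
    conjugate, with coefficients the conjugates of the c_a. When the two agree,
    [x] is their half-sum, whose coefficients are fixed by [bar]. *)
Lemma VZ_bar_fixed barl x : is_VZ_bar v barl -> VZ v x -> barl x = x -> real_form x.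
Proof.
move=> barlP [n [c [b [cb xE]]]] bx.
have [w bE] : exists w : 'I_n -> seq (I * nat), b = fun a => Fmonomial v (w a).
  have /boolp.choice[w wE] a : exists w, b a = Fmonomial v w.
    by have [_ [w _ <-]] := cb a; exists w.
  by exists w; apply/funext.
have xE' : x = \sum_(a < n) bar (c a) *: Fmonomial v (w a).
  by rewrite -bx xE bE VZ_bar_sum // => a; have [] := cb a.
have -> : x = \sum_(a < n) (2^-1 * (c a + bar (c a))) *: Fmonomial v (w a).
  apply: (scalerI two_neq0); rewrite scaler_nat mulr2n {1}xE {1}xE' bE.
  rewrite -big_split scaler_sumr; apply: eq_bigr => a _.
  by rewrite !scalerA mulrA divff // mul1r scalerDl.
apply: real_form_sum => a; apply: real_formZ; last exact: real_form_Fmonomial.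
by rewrite rmorphM rmorphD fmorphV rmorph_nat /= bar_invol addrC.
Qed.

End LowerGlobal.

(** * The dual real form and its conjugation *)

Section Form.
Variable f : {biscalar M}.
Hypothesis f_contra : is_contravariant_form v f.

(** By adjunction each F_i in [x] becomes an E_i acting on [y], which reduces to
    (v, y) with y again in the real form; there only the multiple of v counts. *)
Lemma form_real x y : real_form x -> real_form y -> bar (f x y) = f x y.
Proof.
have [fvv f_sym fF _] := f_contra.
move=> rx ry; elim: rx y ry => [w|x1 x2 _ IH1 _ IH2|c x1 bc _ IH1] y ry; last 2 first.
- by rewrite linearDl rmorphD IH1 // IH2.
- by rewrite linearZl_LR rmorphM /= bc IH1.
elim: w y ry => [|i w IHw] y ry /=; last by rewrite fF IHw //; apply: real_form_E.
elim: ry => [w|y1 y2 _ IH1 _ IH2|c y1 bc _ IH1]; last 2 first.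
- by rewrite linearDr rmorphD IH1 IH2.
- by rewrite linearZr_LR rmorphM /= bc IH1.
case: w => [|i w] /=; first by rewrite fvv rmorph1.
by rewrite f_sym fF Ev linear0r rmorph0.
Qed.

(** The graph of the semilinear involution attached to the real form dual to
    [real_form]: this form of the definition refers to no basis, so that its
    compatibility with the module structure follows from adjunction. *)
Definition conjugate x y := forall m, real_form m -> f m y = bar (f m x).

Lemma conjugate_E i x y : conjugate x y -> conjugate (Eop M i x) (Eop M i y).
Proof.
have [_ _ fF _] := f_contra => xy m rm.
by rewrite -!fF; apply: xy; apply: real_form_F.
Qed.

Lemma conjugate_F i x y : conjugate x y -> conjugate (Fop M i x) (Fop M i y).
Proof.
have [_ f_sym fF _] := f_contra => xy m rm.
by rewrite !(f_sym m) !fF !(f_sym _ (Eop M i m)); apply: xy; apply: real_form_E.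
Qed.

Lemma conjugate_K a x y : half_wlat D a ->
  conjugate x y -> conjugate (Kop M a x) (Kop M (- a) y).
Proof.
have [_ _ _ fK] := f_contra => Ha xy m; have HNa := half_wlat_opp Ha.
elim=> [w|m1 m2 _ IH1 _ IH2|c m1 bc _ IH1].
- have [c Kc KNc] := Fword_weight w Ha.
  rewrite -!fK // Kc KNc !linearZl_LR rmorphM /=; congr (_ * _).
  by apply: xy; apply: real_form_word.
- by rewrite !linearDl rmorphD IH1 IH2.
- by rewrite !linearZl_LR rmorphM /= bc IH1.
Qed.

Lemma conjugate_sum n (c : 'I_n -> k) (x : 'I_n -> M) :
  (forall a, conjugate (x a) (x a)) ->
  conjugate (\sum_(a < n) c a *: x a) (\sum_(a < n) bar (c a) *: x a).
Proof.
move=> xx m rm; rewrite !linear_sumr rmorph_sum; apply: eq_bigr => a _.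
by rewrite !linearZr_LR rmorphM /=; congr (_ * _); apply: xx.
Qed.

Section Bases.
Context {T : choiceType}.
Variables (S : set T) (G G' : T -> M).
Hypothesis G_real : forall b, S b -> real_form (G b).
Hypotheses (G_basis : is_family_basis S G) (G'_basis : is_family_basis S G').
Hypothesis dualGG' : forall b b', S b -> S b' -> f (G b) (G' b') = (b == b')%:R.

Lemma conjugate_unique x y y' : conjugate x y -> conjugate x y' -> y = y'.
Proof.
move=> xy xy'; apply/eqP; rewrite -subr_eq0; apply/eqP.
apply: (dual_basis_inj dualGG' G'_basis) => b Sb.
by rewrite linearBr; apply/eqP; rewrite subr_eq0 xy ?xy' //; apply: G_real.
Qed.

Lemma form_real_eq0 z : (forall y, real_form y -> f z y = 0) -> forall y, f z y = 0.
Proof.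
move=> fz0 y; have [n [c [b [Sb ->]]]] := G_basis.1 y.
rewrite linear_sumr big1 // => a _.
by rewrite linearZr_LR /= fz0 ?mulr0 //; apply: G_real.
Qed.

(** Write m in the real form as the sum of the c_a G(b_a). The difference of m
    and the sum of the conjugates of the c_a times G(b_a) is orthogonal to the
    real form, since all values of the form involved are fixed by [bar]; hence
    it is orthogonal to G'(b0), and this compares the coefficients at b0. *)
Lemma conjugate_dual b0 : S b0 -> conjugate (G' b0) (G' b0).
Proof.
move=> Sb0 m rm; have [n [c [b [Sb mE]]]] := G_basis.1 m.
have coefE e : f (\sum_(a < n) e a *: G (b a)) (G' b0)
             = \sum_(a < n) e a * (b a == b0)%:R.
  by rewrite linear_sumlz; apply: eq_bigr => a _; rewrite linearZl_LR dualGG'.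
have z0 : f (\sum_(a < n) (c a - bar (c a)) *: G (b a)) (G' b0) = 0.
  apply: form_real_eq0 => y ry; transitivity (f m y - bar (f m y)); last first.
    by rewrite form_real // subrr.
  rewrite mE !linear_sumlz rmorph_sum -sumrB; apply: eq_bigr => a _.
  rewrite !linearZl_LR rmorphM /= mulrBl; congr (_ - _ * _).
  by rewrite form_real //; apply: G_real.
have := z0; rewrite mE !coefE rmorph_sum => /eqP.
under eq_bigr => a _ do rewrite mulrBl.
rewrite sumrB subr_eq0 => /eqP->; apply: eq_bigr => a _.
by rewrite rmorphM /= rmorph_nat.
Qed.

Lemma conjugate_exists x : exists y, conjugate x y.
Proof.
have [n [c [b [Sb ->]]]] := G'_basis.1 x.
by eexists; apply: conjugate_sum => a; apply: conjugate_dual.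
Qed.

End Bases.
End Form.
End RealForm.

(** * Conjugation on an integrable module *)

Section Conjugation.
Context {R : realType} {I : finType} {h : vectType R[i]}.
Variable D : root_data I h.
Context {k : fieldType} {t : k}.
Variable bar : {rmorphism k -> k}.
Hypotheses (bar_invol : involutive bar) (bar_t : bar t = t^-1).
Hypotheses (t_neq0 : t != 0) (two_neq0 : 2 != 0 :> k).
Variables (V : Uq_module D t) (GB : set V) (barV : {additive V -> V}).
Hypothesis barV_scale : forall (c : k) b, GB b -> barV (c *: b) = bar c *: b.

(** A condition on single vectors, closed under sums: this reduces the
    properties of [barV] to vectors in the simple summands of [V]. *)
Definition bar_compatible (x : V) :=
  [/\ barV (barV x) = x, forall c, barV (c *: x) = bar c *: barV x,
      forall i, barV (Eop V i x) = Eop V i (barV x),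
      forall i, barV (Fop V i x) = Fop V i (barV x)
    & forall a, half_wlat D a -> barV (Kop V a x) = Kop V (- a) (barV x)].

Lemma bar_compatible_sum n (x : 'I_n -> V) :
  (forall r, bar_compatible (x r)) -> bar_compatible (\sum_(r < n) x r).
Proof.
move=> bx; apply: big_ind => // [|y z [yb yZ yE yF yK] [zb zZ zE zF zK]].
  by split=> *; rewrite ?scaler0 ?linear0 ?raddf0 ?scaler0 ?linear0.
split=> *; rewrite ?scalerDr ?linearD ?raddfD ?scalerDr ?linearD /=.
- by rewrite yb zb.
- by rewrite yZ zZ.
- by rewrite yE zE.
- by rewrite yF zF.
- by rewrite yK ?zK.
Qed.

(** On the summand [M], [barV] is the involution with graph [conjugate]. *)
Lemma bar_compatible_simple (M : Uq_module D t) (l : 'Hom(h, R[i]^o)) (v : M)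
    (BB : set M) (phi : {linear M -> V}) x :
  is_simple_hw l v -> is_simple_upper_global_basis v BB ->
  is_Uq_morphism phi -> (forall b, BB b -> GB (phi b)) ->
  bar_compatible (phi x).
Proof.
move=> [_ _ _ v_weight Ev].
move=> [f [G [G' [f_contra [G_basis [barl barlP G_lower]] G'_basis dualGG' BBE]]]].
move=> [phiE phiF phiK] phi_BB.
have G_real b : low_basis v b -> real_form bar v (G b).
  move=> /G_lower[ZG _ bG _].
  exact: (VZ_bar_fixed bar_invol bar_t t_neq0 two_neq0 barlP ZG bG).
have C_dual := conjugate_dual bar_invol bar_t v_weight Ev f_contra G_real G_basis dualGG'.
have barE y z : conjugate bar v f y z -> barV (phi y) = phi z.
  move=> yz; have [n [c [b [Sb yE]]]] := G'_basis.1 y.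
  have yz' : conjugate bar v f y (\sum_(a < n) bar (c a) *: G' (b a)).
    by rewrite yE; apply: conjugate_sum => a; apply: C_dual.
  rewrite (conjugate_unique G_real G'_basis dualGG' yz yz') yE !linear_sum raddf_sum.
  apply: eq_bigr => a _; rewrite !linearZ barV_scale //.
  by apply: phi_BB; rewrite BBE; exists (b a).
have [y xy] := conjugate_exists bar_invol bar_t v_weight Ev f_contra G_real G_basis
                 G'_basis dualGG' x.
rewrite /bar_compatible (barE _ _ xy); split=> [|c|i|i|a Ha].
- by apply: barE => m rm; rewrite xy ?bar_invol.
- rewrite -!linearZ; apply: barE => m rm.
  by rewrite !linearZr_LR xy // rmorphM.
- by rewrite -!phiE; apply: barE; apply: conjugate_E.
- rewrite -!phiF; apply: barE.
  exact: (conjugate_F bar_invol bar_t v_weight Ev f_contra).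
- rewrite -!phiK //; last exact: half_wlat_opp.
  by apply: barE; apply: (conjugate_K bar_t v_weight f_contra Ha).
Qed.

Lemma bar_compatible_global L B x :
  is_upper_global_basis L B GB -> bar_compatible x.
Proof.
move=> [X [M [l [v [BB [phi [simpleM [span_phi _] _ _ GBE]]]]]]].
have [n [a [y ->]]] := span_phi x; apply: bar_compatible_sum => r.
have [_ hw upper mor] := simpleM (a r).
apply: (bar_compatible_simple _ hw upper mor) => b BBb.
by rewrite GBE; exists (a r), b.
Qed.

(** * The operators sigma *)

Section Sigma.
Hypothesis compat : forall x, bar_compatible x.

(** K_a barV = barV K_-a, and K_-a acts on [x] by q^-(a, b), whose conjugate is
    q^(a, b). *)
Lemma barV_wspace b x : wspace b x -> wspace b (barV x).
Proof.
move=> xb a Ha; have HNa := half_wlat_opp Ha; have [_ xZ _ _ xK] := compat x.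
rewrite -[a]opprK -xK // xb // xZ (bar_qpow D bar_t).
by rewrite opprK linearNl opprK.
Qed.

Lemma barV_Fw s a x : barV (Fw s a x) = Fw s a (barV x).
Proof.
elim: s => //= i s IHs; rewrite -IHs /Fdiv /divpow; set n := to_nat _.
have [_ -> _ _ _] := compat (iter n (Fop V i) (Fw s a x)).
rewrite fmorphV bar_qfact ?(bar_qi D bar_t) //; congr (_ *: _).
by elim: n => //= n <-; have [_ _ _ -> _] := compat (iter n (Fop V i) (Fw s a x)).
Qed.

Variable sigma : {linear V -> V}.

Definition conj_sigma x := barV (sigma (barV x)).

Lemma conj_sigma_linear : linear conj_sigma.
Proof.
move=> c x y; rewrite /conj_sigma !raddfD /=; congr (_ + _).
have [_ -> _ _ _] := compat x; rewrite linearZ /=.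
by have [_ -> _ _ _] := compat (sigma (barV x)); rewrite bar_invol.
Qed.

HB.instance Definition _ :=
  GRing.isLinear.Build k V V *:%R conj_sigma conj_sigma_linear.

Lemma conj_sigma_spec J s : sigma_spec J s sigma -> sigma_spec J s conj_sigma.
Proof.
move=> [hwt sF sE]; split=> [n l x inj_l wx ker_x|j j' m st|j j' m st].
- rewrite /= /conj_sigma raddf_sum (hwt _ l) => [|//|a|j Jj].
  + rewrite raddf_sum; apply: eq_bigr => a _.
    by rewrite barV_Fw; have [-> _ _ _ _] := compat (x a).
  + by have [? ?] := wx a; split=> //; apply: barV_wspace.
  + rewrite -raddf_sum; have [_ _ <- _ _] := compat (\sum_(a < n) x a).
    by rewrite ker_x ?raddf0.
- rewrite /= /conj_sigma; have [_ _ _ -> _] := compat m.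
  by rewrite (sF _ _ _ st); have [_ _ -> _ _] := compat (sigma (barV m)).
- rewrite /= /conj_sigma; have [_ _ -> _ _] := compat m.
  by rewrite (sE _ _ _ st); have [_ _ _ -> _] := compat (sigma (barV m)).
Qed.

(** The uniqueness of [sigma], applied to its conjugate. *)
Lemma sigma_bar J s x : is_sigma J s sigma -> barV (sigma (barV x)) = sigma x.
Proof. by move=> [spec uniq]; apply: (uniq _ (conj_sigma_spec spec)). Qed.

End Sigma.
End Conjugation.

Theorem proposition5p8 (R : realType) (I : finType) (h : vectType R[i])
    (D : root_data I h) (k : fieldType) (t : k)
    (char_k : [pchar k] =i pred0)
    (t_transcendental : ~ algebraicOver (ratr : rat -> k) t)
    (V : Uq_module D t) (V_Oint : in_Oint V)
    (L : set V) (B : set (set V)) (LB_crystal : is_upper_crystal_basis L B)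
    (GB : set V) (GB_global : is_upper_global_basis L B GB)
    (bar : {rmorphism k -> k}) (bar_invol : involutive bar) (bar_t : bar t = t^-1)
    (barV : {additive V -> V}) (barV_basis : forall b, GB b -> barV b = b)
    (barV_scale : forall (f : k) b, GB b -> barV (f *: b) = bar f *: b)
    (J : {set I}) (J_finite : finite_parabolic D J)
    (s : seq I) (s_longest : reduced_longest D J s)
    (sigma : {linear V -> V}) (sigma_J : is_sigma J s sigma)
    (b : V) (b_GB : GB b) :
  barV (sigma b) = sigma b.
Proof.
have t_neq0 : t != 0.
  apply/eqP => t0; apply: t_transcendental; exists 'X; first by rewrite polyX_eq0.
  have ratr0 : ratr 0 = 0 :> k by rewrite /ratr (_ : numq 0 = 0) // mul0r.
  by rewrite /root t0 horner_coef0 coef_map_id0 ?coefX ?ratr0.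
have two_neq0 : 2 != 0 :> k by have /pcharf0P-> := char_k.
have compat x := bar_compatible_global bar_invol bar_t t_neq0 two_neq0
                   barV_scale x GB_global.
rewrite -[in LHS](barV_basis b b_GB).
exact: (sigma_bar bar_invol bar_t compat _ sigma_J).
Qed.
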